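(* Let $G=(V,E)$ be a finite strongly connected directed graph (loops and multiple arcs allowed), let $s\in V$ and let $T\subseteq V$ be nonempty such that every arc leaving a vertex of $T$ ends at $s$. Fix at every vertex $v$ a rotor mechanism $e_v^1,\dots,e_v^{d(v)}$ with heads $v^1,\dots,v^{d(v)}$, and suppose every rotor mechanism is palindromic: $v^i=v^{d(v)+1-i}$ for all $v\in V$ and $1\le i\le d(v)$. Then the hitting sequence $(t_n)_{n\ge1}$ is palindromic: for every $D\ge1$ with $t_{n+D}=t_n$ for all $n\ge1$, one has $t_i=t_{D+1-i}$ for all $1\le i\le D$.
   Context: $d(v)$ is the out-degree of $v$. A rotor mechanism at $v$ is an ordering $e_v^1,\dots,e_v^{d(v)}$ of the arcs leaving $v$, extended to all $i\in\mathbb{Z}$ periodically with period $d(v)$; $v^i$ is the head of $e_v^i$. The rotor walk from $s$ is the infinite sequence $x_0=s,x_1,\dots$ in which, for every vertex $v$ and $i\ge1$, the $i$-th occurrence of $v$ is immediately followed by $v^i$; the hitting sequence is the subsequence of terms of the rotor walk lying in $T$. *)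

(* Defs.v *)
From mathcomp Require Import all_boot all_order all_algebra.
From mathcomp Require Import zify.
From Stdlib Require Classical_Prop.

Set Implicit Arguments.
Unset Strict Implicit.
Unset Printing Implicit Defensive.

Import Order.TTheory GRing.Theory Num.Theory.
Local Open Scope ring_scope.

(* A finite directed multigraph is given by finite types V of vertices and E of
   arcs, with the tail and head of each arc; loops and parallel arcs are
   allowed. *)

Definition outdeg (V E : finType) (tail : E -> V) (v : V) : nat :=
  #|[set a : E | tail a == v]|.

Definition strongly_connected (V E : finType) (tail head : E -> V) : Prop :=
  forall u v : V,
    connect [rel x y | [exists a : E, (tail a == x) && (head a == y)]] u v.

(* The periodic extension is part of the data: r i is e_v^i for every i : int.
   As r takes values in E, it exists only if there is at least one arc; in a
   strongly connected graph this excludes exactly the one-vertex graph without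
   arcs, on which no rotor walk exists, and makes all out-degrees positive. *)
Definition rotor_mechanism (V E : finType) (tail : E -> V) (v : V)
    (r : int -> E) : Prop :=
  perm_eq [seq r i%:Z | i <- iota 1 (outdeg tail v)]
          (enum [set a : E | tail a == v])
  /\ (forall i : int, r (i + (outdeg tail v)%:Z) = r i).

Definition palindromic_rotor (V E : finType) (tail head : E -> V) (v : V)
    (r : int -> E) : Prop :=
  forall i : int, 1 <= i <= (outdeg tail v)%:Z ->
    head (r i) = head (r ((outdeg tail v)%:Z + 1 - i)).

(* The i-th (counting from 1) term of x_0, x_1, ... satisfying P is x_m. *)
Definition nth_visit (V : Type) (x : nat -> V) (P : pred V) (i m : nat) : bool :=
  P (x m) && (count P (mkseq x m.+1) == i).

Definition rotor_walk (V E : finType) (head : E -> V) (e : V -> int -> E)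
    (s : V) (x : nat -> V) : Prop :=
  x 0%N = s
  /\ (forall (v : V) (i m : nat), (1 <= i)%N -> nth_visit x (pred1 v) i m ->
        x m.+1 = head (e v i%:Z)).

(* Hitting sequences are indexed from 1; the value t 0 is irrelevant. *)
Definition hitting_sequence (V : finType) (x : nat -> V) (T : {set V})
    (t : nat -> V) : Prop :=
  forall n : nat, (1 <= n)%N ->
    exists m : nat, nth_visit x (mem T) n m /\ t n = x m.

(* rotor_walk and hitting_sequence are stated as characterizations; the lemmas
   below justify speaking of "the" walk and "the" (infinite) hitting sequence. *)

Section ExistsUnique.

Variables (V E : finType) (tail head : E -> V) (e : V -> int -> E) (s : V).

Lemma mkseqS (x : nat -> V) n : mkseq x n.+1 = rcons (mkseq x n) (x n).
Proof. by rewrite /mkseq -addn1 iotaD map_cat cats1 add0n. Qed.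

Lemma count_mkseqS (x : nat -> V) (P : pred V) n :
  count P (mkseq x n.+1) = (count P (mkseq x n) + P (x n))%N.
Proof. by rewrite mkseqS -cats1 count_cat /= addn0. Qed.

Lemma count_mkseq_mono (x : nat -> V) (P : pred V) m n :
  (m <= n)%N -> (count P (mkseq x m) <= count P (mkseq x n))%N.
Proof.
move=> /subnKC <-; elim: (n - m)%N => [|k IH]; first by rewrite addn0.
by rewrite addnS count_mkseqS (leq_trans IH) ?leq_addr.
Qed.

Lemma nth_visit_inj (x : nat -> V) (P : pred V) i m1 m2 :
  nth_visit x P i m1 -> nth_visit x P i m2 -> m1 = m2.
Proof.
have aux a b : (a < b)%N -> nth_visit x P i a -> nth_visit x P i b -> False.
  move=> lab /andP[_ /eqP ca] /andP[Pb]; rewrite count_mkseqS Pb => /eqP cb.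
  by have := count_mkseq_mono x P lab; lia.
by case: (ltngtP m1 m2) => // l h1 h2; [case: (aux _ _ l) | case: (aux _ _ l)].
Qed.

Fixpoint walk_history (n : nat) : seq V :=
  if n is n'.+1 then
    let h := walk_history n' in
    let v := seq.head s h in
    head (e v (count_mem v h)%:Z) :: h
  else [:: s].

Lemma rotor_walk_exists : exists x, rotor_walk head e s x.
Proof.
pose x n := seq.head s (walk_history n).
have hE n : walk_history n = rev (mkseq x n.+1).
  by elim: n => [//|n IH]; rewrite mkseqS rev_rcons -IH.
exists x; split=> // v i m _ /andP[/= /eqP xm /eqP ci].
rewrite /x /= -/(x m) xm; congr (head (e v _%:Z)).
by rewrite hE count_rev.
Qed.

Lemma rotor_walk_step x m : rotor_walk head e s x ->
  x m.+1 = head (e (x m) (count_mem (x m) (mkseq x m.+1))%:Z).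
Proof.
case=> _; apply; last by rewrite /nth_visit /= !eqxx.
by rewrite count_mkseqS /= eqxx addn1.
Qed.

Lemma rotor_walk_unique x y :
  rotor_walk head e s x -> rotor_walk head e s y -> x =1 y.
Proof.
move=> wx wy; elim/ltn_ind=> -[_|m IH]; first by case: wx wy => -> _ [->].
rewrite (rotor_walk_step _ wx) (rotor_walk_step _ wy) (IH m) //.
suff -> : mkseq x m.+1 = mkseq y m.+1 by [].
by apply/eq_in_map => k; rewrite mem_iota => /andP[_ hk]; apply: IH.
Qed.

Lemma hitting_sequence_unique (x : nat -> V) (T : {set V}) t t' n :
  hitting_sequence x T t -> hitting_sequence x T t' -> (1 <= n)%N ->
  t n = t' n.
Proof.
move=> ht ht' n0; have [m [hm ->]] := ht n n0; have [m' [hm' ->]] := ht' n n0.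
by rewrite (nth_visit_inj hm hm').
Qed.

Definition inf_often (x : nat -> V) (P : pred V) : Prop :=
  forall N, exists2 m, (N <= m)%N & P (x m).

Lemma inf_often_nth (x : nat -> V) (P : pred V) i :
  inf_often x P -> (0 < i)%N -> exists m, nth_visit x P i m.
Proof.
move=> hP; elim: i => // i IH _.
have [N cN] : exists N, count P (mkseq x N) = i.
  case: i IH => [_|i IH]; first by exists 0%N.
  by have [m /andP[_ /eqP cm]] := IH isT; exists m.+1.
have ex : exists m, (N <= m)%N && P (x m).
  by have [m h1 h2] := hP N; exists m; rewrite h1.
case: (ex_minnP ex) => m /andP[Nm Pm] minm; exists m.
rewrite /nth_visit Pm count_mkseqS Pm /= addn1 eqSS -cN.
apply/eqP; have : forall k, (N <= k <= m)%N ->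
    count P (mkseq x k) = count P (mkseq x N).
  elim=> [|k IHk] hk; first by have -> : N = 0%N by lia.
  have [->//|Nk] := eqVneq N k.+1.
  rewrite count_mkseqS IHk; last by lia.
  case Pk: (P (x k)); last by rewrite addn0.
  have := minm k; rewrite Pk andbT => /(_ ltac:(lia)); lia.
by apply; rewrite Nm leqnn.
Qed.

Lemma hitting_sequence_exists x (T : {set V}) :
  strongly_connected tail head -> T != set0 ->
  (forall v, rotor_mechanism tail v (e v)) ->
  rotor_walk head e s x ->
  exists t, hitting_sequence x T t.
Proof.
move=> sc /set0Pn[w wT] rm wx.
have [u hu] : exists u, inf_often x (pred1 u).
  apply: Classical_Prop.NNPP => no.
  have : forall r : seq V, exists N, forall m, (N <= m)%N -> x m \notin r.
    elim=> [|u r [N IH]]; first by exists 0%N.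
    have [N' hN'] : exists N', forall m, (N' <= m)%N -> x m != u.
      apply: Classical_Prop.NNPP => no'; apply: no; exists u => M.
      apply: Classical_Prop.NNPP => no2; apply: no'; exists M => m Nm.
      by apply/negP => xm; apply: no2; exists m.
    exists (maxn N N') => m; rewrite geq_max => /andP[h1 h2].
    by rewrite inE negb_or hN' // IH.
  by case/(_ (enum V)) => N /(_ N (leqnn N)); rewrite mem_enum.
have step v v' : inf_often x (pred1 v) ->
    [exists a : E, (tail a == v) && (head a == v')] -> inf_often x (pred1 v').
  move=> hv /existsP[a /andP[ta /eqP ha]] N.
  have [pe per] := rm v.
  have : a \in enum [set a : E | tail a == v] by rewrite mem_enum inE.
  rewrite -(perm_mem pe) => /mapP[j]; rewrite mem_iota => hj aE.
  set d := outdeg tail v in per hj.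
  have perq q : e v (j + q * d)%N%:Z = a.
    elim: q => [|q IH]; first by rewrite mul0n addn0.
    by rewrite -IH -(per (j + q * d)%N%:Z) -PoszD mulSn; congr (e v _%:Z); lia.
  pose i := (j + N * d)%N.
  have Ni : (N < i)%N by rewrite /i; nia.
  have [m hm] := inf_often_nth hv (leq_trans (ltn0Sn N) Ni).
  exists m.+1; last first.
    by case: wx => _ /(_ v i m) -> //; [rewrite /= perq ha | lia].
  case/andP: hm => _ /eqP cm.
  have := count_size (pred1 v) (mkseq x m.+1); rewrite cm size_mkseq; lia.
have hw : inf_often x (pred1 w).
  have /connectP[p] := sc u w.
  elim: p u hu => [|v p IH] u hu /=; first by move=> _ ->.
  by case/andP => uv pth lst; apply: (IH v) => //; apply: step uv.
have hT : inf_often x (mem T).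
  by move=> N; have [m Nm /eqP xm] := hw N; exists m => //=; rewrite xm.
pose t n := if @idP (0 < n)%N is ReflectT n0 then
  x (ex_minn (inf_often_nth hT n0)) else s.
exists t => n n0; rewrite /t; case: {-}_ / idP => // n0'.
by case: ex_minnP => m hm _; exists m.
Qed.

End ExistsUnique.

(* Main.v *)
Require Import Defs.
From mathcomp Require Import all_boot all_order all_algebra.
From mathcomp Require Import zify ring.

(** Extend the counts of rotor outputs to negative numbers of firings.  After
    the [n]-th hit the numbers [F v] of visits solve the balance equation
    [F w = n * (w == s) + sum over v outside T of the number of the first F v
    outputs of v that equal w].  Over the integers a solution need not be
    unique, but its restriction to [T] is: the pointwise minimum [M] of two
    solutions satisfies the equation with [>=], and summing over [w] bounds the
    total of [M] over [T] below by [n], the total of each solution.  Palindromic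
    rotors make the equation odd, so [- F] solves it for [- n]; by pigeonhole,
    whole turns of the rotors solve it for some [N > 0].  Hence the hits of the
    first [N - n] chips are those of the first [N] minus those of the first
    [n], which says that the hitting sequence reads the same backwards. *)

Set Implicit Arguments.
Unset Strict Implicit.
Unset Printing Implicit Defensive.

Import Order.TTheory GRing.Theory Num.Theory.
Local Open Scope ring_scope.

(** * Signed counts of rotor outputs *)

Section SignedCount.

Variable V : finType.
Implicit Types (u : int -> V) (k : int) (w : V).

(* The number of i in ]0, k] with u i = w, or, for k < 0, minus the number of
   i in ]k, 0]. *)
Definition signed_count u k w : int :=
  match k with
  | Posz n => \sum_(i < n) (u i.+1%:Z == w)%:Z
  | Negz n => - \sum_(i < n.+1) (u (- i%:Z) == w)%:Z
  end.

Lemma signed_count0 u w : signed_count u 0 w = 0.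
Proof. by rewrite /= big_ord0. Qed.

Lemma signed_countS u k w :
  signed_count u (k + 1) w = signed_count u k w + (u (k + 1) == w)%:Z.
Proof.
case: k => [n|[|n]].
- by rewrite -PoszD addn1 /= big_ord_recr.
- rewrite (_ : Negz 0 + 1 = 0) // signed_count0 /= big_ord_recl big_ord0.
  by rewrite oppr0 addr0 addNr.
- rewrite (_ : Negz n.+1 + 1 = Negz n); last by lia.
  rewrite /= [in RHS]big_ord_recr /= opprD -addrA.
  by rewrite (_ : Negz n = - n.+1%:Z) ?NegzE // addNr addr0.
Qed.

Lemma signed_count_le u k l w :
  k <= l -> signed_count u k w <= signed_count u l w.
Proof.
move=> kl; have -> : l = k + `|l - k|%N%:Z by lia.
elim: `|l - k|%N => [|n IH]; first by rewrite addr0.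
rewrite -addn1 PoszD addrA signed_countS (le_trans IH) // lerDl.
by case: (_ == _).
Qed.

Lemma sum_delta (v : V) : \sum_w (v == w)%:Z = 1.
Proof.
rewrite (bigD1 v) //= eqxx big1 ?addr0 // => w.
by rewrite eq_sym => /negbTE->.
Qed.

Lemma sum_signed_count u k : \sum_w signed_count u k w = k.
Proof.
have step l : \sum_w signed_count u (l + 1) w = \sum_w signed_count u l w + 1.
  by under eq_bigr do rewrite signed_countS; rewrite big_split /= sum_delta.
elim/int_rect: k => [|n IH|n IH].
- by rewrite big1 // => w _; apply: signed_count0.
- by rewrite -addn1 PoszD step IH.
- have := step (- n.+1%:Z).
  rewrite (_ : - n.+1%:Z + 1 = - n%:Z); last by lia.
  by rewrite IH => h; lia.
Qed.

(** The reflection [i] to [1 - i] exchanges the windows ]0, k] and ]-k, 0], the second of which is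
    counted negatively. *)
Lemma signed_count_opp u k w : (forall i, u (1 - i) = u i) ->
  signed_count u (- k) w = - signed_count u k w.
Proof.
move=> pal.
have opp_nat n : signed_count u (- n%:Z) w = - signed_count u n%:Z w.
  elim: n => [|n IH]; first by rewrite oppr0 signed_count0 oppr0.
  have := signed_countS u (- n.+1%:Z) w.
  rewrite (_ : - n.+1%:Z + 1 = - n%:Z); last by lia.
  have := signed_countS u n%:Z w; rewrite -PoszD addn1 IH -(pal n.+1%:Z).
  rewrite (_ : 1 - n.+1%:Z = - n%:Z); last by lia.
  set A := signed_count u (- n.+1%:Z) w; set B := signed_count u n.+1%:Z w.
  by lia.
by case: k => n; rewrite ?opp_nat // NegzE opprK opp_nat opprK.
Qed.

Lemma signed_count_shift u (L : int) k c w : (forall i, u (i + L) = u i) ->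
  signed_count u (k + c * L) w = signed_count u k w + c * signed_count u L w.
Proof.
move=> per.
have shift1 l : signed_count u (l + L) w = signed_count u l w + signed_count u L w.
  have step k' : signed_count u (k' + 1 + L) w =
      signed_count u (k' + L) w + (u (k' + 1) == w)%:Z.
    by rewrite -[in RHS]per (addrAC k' 1 L) signed_countS.
  elim/int_rect: l => [|n IH|n IH].
  - by rewrite add0r signed_count0 add0r.
  - by rewrite -addn1 PoszD step IH signed_countS addrAC.
  - have := step (- n.+1%:Z); have := signed_countS u (- n.+1%:Z) w.
    rewrite (_ : - n.+1%:Z + 1 = - n%:Z); last by lia.
    rewrite IH => -> h; apply: (addIr (u (- n%:Z) == w)%:Z).
    by rewrite -h addrAC.
elim/int_rect: c => [|n IH|n IH].
- by rewrite !mul0r !addr0.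
- by rewrite -addn1 PoszD !mulrDl !mul1r addrA shift1 IH addrA.
- have := shift1 (k + - n.+1%:Z * L).
  rewrite (_ : k + - n.+1%:Z * L + L = k + - n%:Z * L) ?IH; last first.
    by rewrite -addn1 PoszD; ring.
  move=> h; apply: (addIr (signed_count u L w)).
  by rewrite -h -addn1 PoszD; ring.
Qed.

End SignedCount.

Arguments signed_count : simpl never.

(** * The balance equation over the integers *)

Section Balance.

Variables (V : finType) (u : V -> int -> V) (s : V) (T : {set V}).

(** Vertices of [T] absorb chips: they never fire, and the move to [s] after a hit counts as the
    insertion of a new chip. *)
Definition balanced (n : int) (F : V -> int) : Prop :=
  forall w, F w = n * (s == w)%:Z
                  + \sum_(v | v \notin T) signed_count (u v) (F v) w.

(** Each firing has exactly one output, so the outputs of [v] over all [w] total [F v]. *)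
Lemma sum_balance (n : int) (F : V -> int) :
  \sum_w (n * (s == w)%:Z + \sum_(v | v \notin T) signed_count (u v) (F v) w)
  = n + \sum_(v | v \notin T) F v.
Proof.
rewrite big_split /= -big_distrr /= sum_delta mulr1 exchange_big /=.
by congr (_ + _); apply: eq_bigr => v _; rewrite sum_signed_count.
Qed.

Lemma sum_split (F : V -> int) :
  \sum_(v in T) F v + \sum_(v | v \notin T) F v = \sum_v F v.
Proof. by rewrite [RHS](bigID (mem T)). Qed.

Lemma balanced_sum (n : int) F : balanced n F -> \sum_(v in T) F v = n.
Proof.
move=> bF; apply: (addIr (\sum_(v | v \notin T) F v)).
by rewrite sum_split -sum_balance; apply: eq_bigr.
Qed.

Lemma le_sum_eq (F G : V -> int) : (forall v, F v <= G v) ->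
  \sum_(v in T) G v <= \sum_(v in T) F v -> {in T, F =1 G}.
Proof.
move=> FG sFG w wT; apply/le_anti; rewrite FG /=.
move: sFG; rewrite (bigD1 w) //= [X in _ <= X](bigD1 w) //=.
have leFG : \sum_(v in T | v != w) F v <= \sum_(v in T | v != w) G v.
  exact: ler_sum.
move=> sFG; rewrite -(lerD2r (\sum_(v in T | v != w) F v)).
by apply: le_trans sFG; rewrite lerD2l.
Qed.

Lemma balanced_unique (n : int) F G :
  balanced n F -> balanced n G -> {in T, F =1 G}.
Proof.
move=> bF bG; pose M v := Num.min (F v) (G v).
have MF v : M v <= F v by rewrite /M ge_min lexx.
have MG v : M v <= G v by rewrite /M ge_min lexx orbT.
(* Signed counts are monotone in the number of firings, so the right-hand side at [M] is below both
   [F w] and [G w]. *)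
have superM w :
    n * (s == w)%:Z + \sum_(v | v \notin T) signed_count (u v) (M v) w <= M w.
  rewrite {2}/M le_min bF bG !lerD2l.
  by apply/andP; split; apply: ler_sum => v _; apply: signed_count_le.
(* On summing over all [w], the contributions of the vertices outside [T] cancel. *)
have nM : n <= \sum_(v in T) M v.
  rewrite -(lerD2r (\sum_(v | v \notin T) M v)) sum_split -sum_balance.
  exact: ler_sum.
have MFT := le_sum_eq MF; have MGT := le_sum_eq MG.
rewrite (balanced_sum bF) in MFT; rewrite (balanced_sum bG) in MGT.
by move=> w wT; rewrite -(MFT nM) // -(MGT nM).
Qed.

Lemma balanced_opp (n : int) F : (forall v i, u v (1 - i) = u v i) ->
  balanced n F -> balanced (- n) (fun v => - F v).
Proof.
move=> pal bF w; rewrite {1}bF opprD mulNr -sumrN.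
by congr (_ + _); apply: eq_bigr => v _; rewrite signed_count_opp.
Qed.

Variable L : int.
Hypothesis perL : forall v i, u v (i + L) = u v i.

(** Subtracting the two balance equations cancels the counts at [F]; what remains is linear in [c]
    and free of [F], so the same turns can later be added to any solution. *)
Lemma balanced_turns (n m : int) F (c : V -> int) :
  balanced n F -> balanced m (fun v => F v + c v * L) ->
  forall w, c w * L = (m - n) * (s == w)%:Z
                      + \sum_(v | v \notin T) c v * signed_count (u v) L w.
Proof.
move=> bF bFc w; have := bFc w; have := bF w.
under [in X in _ -> X -> _]eq_bigr do rewrite signed_count_shift //.
rewrite big_split /=; set A := \sum_(v | _) _; set B := \sum_(v | _) _ => /= -> h.
apply: (addrI (n * (s == w)%:Z + A)); rewrite h; ring.
Qed.

Lemma balanced_add_turns (n N : int) F (c : V -> int) :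
  (forall w, c w * L = N * (s == w)%:Z
                       + \sum_(v | v \notin T) c v * signed_count (u v) L w) ->
  balanced n F -> balanced (n + N) (fun v => F v + c v * L).
Proof.
move=> turns bF w; rewrite {1}bF turns.
under [in RHS]eq_bigr do rewrite signed_count_shift //.
rewrite big_split /=; ring.
Qed.

End Balance.

(** * Visits and hits of the rotor walk *)

Section Walk.

Variables (V E : finType) (head : E -> V) (e : V -> int -> E) (s : V).
Variables (T : {set V}) (x t : nat -> V).
Hypothesis headT : forall v i, v \in T -> head (e v i) = s.
Hypothesis walk_x : rotor_walk head e s x.
Hypothesis hit_t : hitting_sequence x T t.

Let u v i := head (e v i).
Let visits m v : nat := count_mem v (mkseq x m).

(** Each term up to [x m] is the start, the return to [s] after a hit, or an output of a vertex
    outside [T]. The right side stops at [m] because [x m] has not fired yet. *)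
Lemma visits_balance m w :
  (visits m.+1 w)%:Z = (1 + (count (mem T) (mkseq x m))%:Z) * (s == w)%:Z
    + \sum_(v | v \notin T) signed_count (u v) (visits m v)%:Z w.
Proof.
elim: m => [|m IH].
  rewrite /visits /= addn0 (proj1 walk_x) addr0 mul1r.
  by rewrite big1 ?addr0 // => v _; apply: signed_count0.
have vS k v : (visits k.+1 v)%:Z = (visits k v)%:Z + (x k == v)%:Z.
  by rewrite /visits count_mkseqS PoszD.
rewrite [LHS]vS IH [in RHS]count_mkseqS PoszD.
have xS : x m.+1 = u (x m) ((visits m (x m))%:Z + 1).
  rewrite (rotor_walk_step _ walk_x) -/(visits m.+1 (x m)).
  by rewrite vS eqxx.
have [xT|xT] := boolP (x m \in T).
  have -> : (x m.+1 == w) = (s == w) by rewrite xS /u headT.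
  have -> : \sum_(v | v \notin T) signed_count (u v) (visits m.+1 v)%:Z w
          = \sum_(v | v \notin T) signed_count (u v) (visits m v)%:Z w.
    apply: eq_bigr => v vT; rewrite vS (_ : (x m == v) = false) ?addr0 //.
    by apply: contraNF vT => /eqP <-.
  by rewrite /= xT -[Posz true]/(1 : int); set A := \sum_(v | _) _; ring.
rewrite (bigD1 (x m)) //= [in RHS](bigD1 (x m)) //= (negbTE xT) addr0.
rewrite [in RHS]vS eqxx signed_countS -xS.
rewrite [in RHS](eq_bigr (fun v => signed_count (u v) (visits m v)%:Z w)).
  by set A := \sum_(v | _) _; set B := signed_count _ _ _; ring.
by move=> v /andP[_]; rewrite vS eq_sym => /negbTE->; rewrite addr0.
Qed.

Definition hits n w : nat := \sum_(1 <= i < n.+1) (t i == w).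

Lemma hitsS n w : hits n.+1 w = (hits n w + (t n.+1 == w))%N.
Proof. by rewrite /hits big_nat_recr. Qed.

Lemma visits_hits m w : w \in T ->
  visits m w = hits (count (mem T) (mkseq x m)) w.
Proof.
move=> wT; elim: m => [|m IH]; first by rewrite /hits big_geq.
rewrite /visits !count_mkseqS -/(visits m w) IH.
have [xT|xT] := boolP (x m \in T).
  rewrite /= xT addn1 hitsS; congr (_ + _)%N.
  have [m' [hm' ->]] := hit_t (ltn0Sn (count (mem T) (mkseq x m))).
  suff hm : nth_visit x (mem T) (count (mem T) (mkseq x m)).+1 m.
    by rewrite (nth_visit_inj hm' hm).
  by rewrite /nth_visit count_mkseqS /= xT addn1 eqxx.
rewrite /= (negbTE xT) (_ : (x m == w) = false) ?addn0 //.
by apply: contraNF xT => /eqP ->.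
Qed.

Lemma hits_balanced (n : nat) : exists F : V -> nat,
  balanced u s T n (fun v => (F v)%:Z) /\ {in T, F =1 hits n}.
Proof.
case: n => [|n].
  exists (fun=> 0%N); split=> [w|w _]; last by rewrite /hits big_geq.
  by rewrite mul0r add0r big1 // => v _; apply: signed_count0.
(* At the time [m] of a hit the vertex [x m] lies in [T], so outside [T] the counts [visits m] and
   [visits m.+1] agree. *)
have [m [/andP[xT /eqP cm] _]] := hit_t (ltn0Sn n).
exists (visits m.+1); split=> [w|w wT]; last by rewrite visits_hits // cm.
rewrite visits_balance.
move: cm; rewrite count_mkseqS xT addn1 => -[->].
rewrite -addn1 PoszD [1 + _]addrC; congr (_ + _); apply: eq_bigr => v vT.
rewrite [in RHS]/visits count_mkseqS /= (_ : (x m == v) = false) ?addn0 //.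
by apply: contraNF vT => /eqP <-.
Qed.

(** * Whole turns of the rotors and reversal of the hits *)

Variable L : nat.
Hypothesis L_gt0 : (0 < L)%N.
Hypothesis perL : forall v i, u v (i + L%:Z) = u v i.
Hypothesis pal : forall v i, u v (1 - i) = u v i.

Lemma exists_turns D : (0 < D)%N -> exists q (c : V -> int), (0 < q)%N /\
  forall w, c w * L%:Z = (q * D)%N%:Z * (s == w)%:Z
    + \sum_(v | v \notin T) c v * signed_count (u v) L%:Z w.
Proof.
move=> D0; pose K : finType := {ffun V -> 'I_L}.
have [F hF] := fin_all_exists (fun k : 'I_#|K|.+1 => hits_balanced (k * D)).
(* Pigeonhole on the rotor positions modulo [L] after [k * D] hits: there is one more [k] than there
   are position vectors. *)
pose f (k : 'I_#|K|.+1) : K := [ffun v => Ordinal (ltn_pmod (F k v) L_gt0)].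
have /injectivePn[k [l kl fkl]] : ~~ injectiveb f.
  by apply/injectiveP => /leq_card; rewrite card_ord ltnn.
wlog lt_kl : k l kl fkl / (k < l)%N.
  move=> wl; case: (ltngtP k l) => [||/ord_inj eq_kl]; first exact: wl.
  - by apply: wl; rewrite // eq_sym.
  - by rewrite eq_kl eqxx in kl.
pose c v := (F l v %/ L)%N%:Z - (F k v %/ L)%N%:Z.
exists (l - k)%N, c; split=> [|w]; first by rewrite subn_gt0.
rewrite mulnBl -subzn ?leq_mul2r ?(ltnW lt_kl) ?orbT //.
apply: (balanced_turns perL (proj1 (hF k))).
suff e_l v : (F k v)%:Z + c v * L%:Z = (F l v)%:Z.
  move=> v; rewrite e_l (proj1 (hF l) v); congr (_ + _).
  by apply: eq_bigr => v' _; rewrite e_l.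
have /(congr1 val) /= : f k v = f l v by rewrite fkl.
rewrite !ffunE /= => e_mod; rewrite /c mulrBl -!PoszM.
by have := divn_eq (F k v) L; have := divn_eq (F l v) L; rewrite e_mod; lia.
Qed.

Lemma hits_reverse D : (0 < D)%N -> exists q, (0 < q)%N /\
  forall n w, (n <= q * D)%N -> w \in T ->
    (hits (q * D - n) w + hits n w)%N = hits (q * D) w.
Proof.
move=> /exists_turns[q [c [q0 turns]]]; exists q; split=> // n w nN wT.
(* Negating the solution for [k] and adding the turns solves the equation for [q * D - k], so by
   uniqueness on [T] the two hit counts have a sum independent of [k]; [k = 0] then identifies
   it. *)
have compl k : (k <= q * D)%N ->
    (hits (q * D - k) w + hits k w)%N%:Z = c w * L%:Z.
  move=> kN; have [F [bF hF]] := hits_balanced k.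
  have [G [bG hG]] := hits_balanced (q * D - k).
  have := balanced_add_turns perL turns (balanced_opp pal bF).
  rewrite addrC subzn // => /(balanced_unique bG) /(_ w wT).
  by rewrite hF // hG // => h; rewrite PoszD h addrAC addNr add0r.
have := compl 0%N (leq0n _); rewrite subn0 -(compl n nN).
by rewrite {2}/hits big_geq // addn0 => -[->].
Qed.

Lemma hitting_palindromic D : (1 <= D)%N ->
  (forall n, (1 <= n)%N -> t (n + D)%N = t n) ->
  forall i, (1 <= i <= D)%N -> t i = t (D + 1 - i)%N.
Proof.
move=> D1 perD i /andP[i1 iD]; have [q [q0 rev_q]] := hits_reverse D1.
have perqD k n : (1 <= n)%N -> t (n + k * D)%N = t n.
  move=> n1; elim: k => [|k IH]; first by rewrite addn0.
  by rewrite mulSnr addnA perD ?IH //; lia.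
have -> : t (D + 1 - i)%N = t (q * D - i).+1.
  rewrite -(perqD q.-1 (D + 1 - i)%N); last by lia.
  by congr t; case: q q0 {rev_q} => // q _; lia.
have iqD : (i <= q * D)%N by nia.
have tT : t i \in T by have [m [/andP[xT _] ->]] := hit_t i1.
(* Comparing the reversals at [i] and [i.-1]: the hit of [t i] at index [i] forces one at index
   [q * D - i + 1]. *)
have := rev_q i (t i) iqD tT; have := rev_q i.-1 (t i) ltac:(lia) tT.
have -> : (q * D - i.-1 = (q * D - i).+1)%N by lia.
have := hitsS i.-1 (t i); rewrite prednK // eqxx => ->; rewrite hitsS.
by case: (t (q * D - i).+1 =P t i) => // _; lia.
Qed.

End Walk.

(** * Rotor mechanisms at arbitrary integer indices *)

Section Rotor.

Variables (V E : finType) (tail head : E -> V) (v : V) (r : int -> E).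
Hypothesis rot : rotor_mechanism tail v r.

Lemma outdeg_gt0 : strongly_connected tail head -> (0 < outdeg tail v)%N.
Proof.
move=> sc; suff [a ta] : exists a, tail a = v.
  by rewrite card_gt0; apply/set0Pn; exists a; rewrite inE ta.
(* The arc [r 0] leaves some vertex; a path from [v] to that vertex is either empty or begins with
   an arc leaving [v]. *)
have /connectP[[|w p] /= vp pE] := sc v (tail (r 0)); first by exists (r 0).
by case/andP: vp => /existsP[a /andP[/eqP ta _]] _; exists a.
Qed.

Lemma rotor_period (c i : int) : r (i + c * (outdeg tail v)%:Z) = r i.
Proof.
have per := proj2 rot; elim/int_rect: c => [|n IH|n IH].
- by rewrite mul0r addr0.
- by rewrite -addn1 PoszD mulrDl mul1r addrA per.
- rewrite -per -[RHS]IH; congr r; rewrite -addn1 PoszD; ring.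
Qed.

Hypothesis d_gt0 : (0 < outdeg tail v)%N.

Lemma rotor_residue (i : int) : exists c j : int,
  1 <= j <= (outdeg tail v)%:Z /\ i = j + c * (outdeg tail v)%:Z.
Proof.
have d0 : (outdeg tail v)%:Z != 0 by lia.
(* The shift by 1 puts residues in the range from 1 to the out-degree. *)
exists (divz (i - 1) (outdeg tail v)%:Z), (modz (i - 1) (outdeg tail v)%:Z + 1).
have := modz_ge0 (i - 1) d0; have := ltz_mod (i - 1) d0.
by have := divz_eq (i - 1) (outdeg tail v)%:Z; lia.
Qed.

Lemma rotor_tail i : tail (r i) = v.
Proof.
have [c [j [j_bnd ->]]] := rotor_residue i; rewrite rotor_period.
have : r j \in [seq r i%:Z | i <- iota 1 (outdeg tail v)].
  apply/mapP; exists `|j|%N; first by rewrite mem_iota; lia.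
  by congr r; lia.
by rewrite (perm_mem (proj1 rot)) mem_enum inE => /eqP.
Qed.

(** Modulo the period [d], the reflection [i] to [d + 1 - i] becomes [1 - i], the same form at every
    vertex. *)
Lemma palindromic_rotor_int : palindromic_rotor tail head v r ->
  forall i, head (r (1 - i)) = head (r i).
Proof.
move=> pal i; have [c [j [j_bnd ->]]] := rotor_residue i.
rewrite rotor_period (pal j) // -[in LHS](rotor_period (1 + c)).
by congr (head (r _)); ring.
Qed.

End Rotor.

Theorem theorem3 (V E : finType) (tail head : E -> V) (s : V) (T : {set V})
    (e : V -> int -> E) (x t : nat -> V) :
  strongly_connected tail head ->
  T != set0 ->
  (forall a : E, tail a \in T -> head a = s) ->
  (forall v : V, rotor_mechanism tail v (e v)) ->
  (forall v : V, palindromic_rotor tail head v (e v)) ->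
  rotor_walk head e s x ->
  hitting_sequence x T t ->
  forall D : nat, (1 <= D)%N ->
    (forall n : nat, (1 <= n)%N -> t (n + D)%N = t n) ->
    forall i : nat, (1 <= i <= D)%N -> t i = t (D + 1 - i)%N.
Proof.
move=> sc _ outT rot pal walk_x hit_t.
have d_gt0 v : (0 < outdeg tail v)%N := outdeg_gt0 v (e v) sc.
(* The product of all out-degrees is a common period of the rotors. *)
apply: (@hitting_palindromic _ _ head e s T x t _ walk_x hit_t
          (\prod_v outdeg tail v)%N) => [v i vT||v i|v i].
- by apply: outT; rewrite (rotor_tail (rot v)).
- exact: prodn_gt0.
- by rewrite (bigD1 v) //= mulnC PoszM (rotor_period (rot v)).
- exact: (palindromic_rotor_int (rot v)).
Qed.
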